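(* Let $\alpha\in\mathbb{C}\setminus\{0,-1\}$, $\mathfrak{g}=D(2,1,\alpha)$, and let $\Delta^{+}$ be the set of positive roots with $\Delta^+_{\bar 0}=\{\beta_1+\beta_2,\beta_1+\beta_3,\beta_2+\beta_3\}$ and $\Delta^+_{\bar 1}=\{\beta_1,\beta_2,\beta_3,\beta_1+\beta_2+\beta_3\}$. For $\lambda\in\mathfrak{h}^{*}$ put $\lambda_i=\lambda(h_i)$ $(i=1,2,3)$ and $$c_1=\frac{\lambda_2+\lambda_3}{-\alpha-1},\qquad c_2=\frac{\lambda_1+\lambda_3}{\alpha},\qquad c_3=\lambda_1+\lambda_2 .$$ Let $L(\lambda)$ be the simple highest weight module of highest weight $\lambda$ with respect to $\Delta^+$. Then for each $\lambda\in\mathfrak{h}^*$, $\operatorname{inj}L(\lambda)=\Delta_{\bar 0}^{-}$ if and only if $c_1,c_2,c_3\notin\mathbb{Z}_{\geq 1}$ and at most one of $\lambda_1,\lambda_2,\lambda_3$ equals zero.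
   Context: The ground field is $\mathbb{C}$. For $\alpha\in\mathbb{C}\setminus\{0,-1\}$, $\mathfrak{g}=\mathfrak{g}_{\bar 0}\oplus\mathfrak{g}_{\bar 1}=D(2,1,\alpha)$ is the contragredient Lie superalgebra $\mathfrak{g}(A)$ with Cartan matrix $$A=(a_{ij})=\begin{pmatrix}0&1&\alpha\\1&0&-\alpha-1\\ \alpha&-\alpha-1&0\end{pmatrix}$$ and three simple roots $\beta_1,\beta_2,\beta_3$, all odd: it is generated by odd $e_i\in\mathfrak{g}_{\beta_i}$, $f_i\in\mathfrak{g}_{-\beta_i}$ and even $h_i$ ($i=1,2,3$), where the $h_i$ form a basis of the Cartan subalgebra $\mathfrak{h}$, with relations $[h_i,h_j]=0$, $[e_i,f_j]=\delta_{ij}h_i$, $[h_i,e_j]=a_{ij}e_j$, $[h_i,f_j]=-a_{ij}f_j$, modulo the maximal ideal intersecting $\mathfrak{h}$ trivially. The set of roots is $\Delta=\Delta_{\bar 0}\cup\Delta_{\bar 1}=\Delta^+\cup(-\Delta^+)$ with $\Delta^+$ as in the claim, and $\Delta^-_{\bar 0}=-\Delta^+_{\bar 0}$. With $\alpha_1=\beta_2+\beta_3$, $\alpha_2=\beta_1+\beta_3$, $\alpha_3=\beta_1+\beta_2$, and $\mathfrak{sl}_2$-triples $E_i\in\mathfrak{g}_{\alpha_i}$, $F_i\in\mathfrak{g}_{-\alpha_i}$, $H_i=[E_i,F_i]$ normalized by $\alpha_i(H_i)=2$, one has $c_i=\lambda(H_i)$. $L(\lambda)$ is the unique simple quotient of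 the Verma module $M(\lambda)$ of highest weight $\lambda$ with respect to $\Delta^+$. For a weight module $M$, $\operatorname{inj}M$ is the set of $\gamma\in\Delta_{\bar 0}$ such that a nonzero $x_\gamma\in\mathfrak{g}_\gamma$ acts injectively on $M$ (root spaces are one-dimensional). *)

(* Defs.v *)
From HB Require Import structures.
From mathcomp Require Import all_boot all_order all_algebra.
From mathcomp Require Import boolp classical_sets reals complex.

Set Implicit Arguments.
Unset Strict Implicit.
Unset Printing Implicit Defensive.

Import GRing.Theory.

Local Open Scope classical_set_scope.
Local Open Scope ring_scope.

Definition subspace (K : numFieldType) (V : lmodType K) (S : set V) : Prop :=
  S 0 /\ forall (a : K) (x y : V), S x -> S y -> S (a *: x + y).

(* Z/2-graded vector spaces: [part false] is the even part, [part true] the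
   odd part. *)
HB.mixin Record isSuperSpace (K : numFieldType) V of GRing.Lmodule K V := {
  part : bool -> set V;
  part_subspace : forall a, subspace (part a);
  part_total : forall x : V,
    exists x0 x1, [/\ part false x0, part true x1 & x = x0 + x1];
  part_direct : forall x : V, part false x -> part true x -> x = 0
}.

#[short(type="superSpaceType")]
HB.structure Definition SuperSpace (K : numFieldType) :=
  {V of isSuperSpace K V & GRing.Lmodule K V}.

(* The field has characteristic 0, so no further axiom on [x, x] (x even) or
   [x, [x, x]] (x odd) is needed. *)
HB.mixin Record isLieSuperalg (K : numFieldType) g of SuperSpace K g := {
  lie : g -> g -> g;
  lie_linearl : forall (a : K) (x y z : g),
    lie (a *: x + y) z = a *: lie x z + lie y z;
  lie_linearr : forall (a : K) (x y z : g),
    lie z (a *: x + y) = a *: lie z x + lie z y;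
  lie_part : forall (a b : bool) (x y : g),
    part a x -> part b y -> part (a (+) b) (lie x y);
  lie_skew : forall (a b : bool) (x y : g),
    part a x -> part b y -> lie x y = - ((-1) ^+ (a && b) *: lie y x);
  lie_jacobi : forall (a b : bool) (x y z : g),
    part a x -> part b y ->
    lie x (lie y z) = lie (lie x y) z + (-1) ^+ (a && b) *: lie y (lie x z)
}.

#[short(type="lieSuperalgType")]
HB.structure Definition LieSuperalg (K : numFieldType) :=
  {g of isLieSuperalg K g & SuperSpace K g}.

HB.mixin Record isLieSuperMod (K : numFieldType) (g : lieSuperalgType K) M
    of SuperSpace K M := {
  act : g -> M -> M;
  act_linearl : forall (a : K) (x y : g) (v : M),
    act (a *: x + y) v = a *: act x v + act y v;
  act_linearr : forall (a : K) (x : g) (u v : M),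
    act x (a *: u + v) = a *: act x u + act x v;
  act_part : forall (a b : bool) (x : g) (v : M),
    part a x -> part b v -> part (a (+) b) (act x v);
  act_lie : forall (a b : bool) (x y : g) (v : M),
    part a x -> part b y ->
    act (lie x y) v = act x (act y v) - (-1) ^+ (a && b) *: act y (act x v)
}.

#[short(type="lieSuperModType")]
HB.structure Definition LieSuperMod (K : numFieldType)
    (g : lieSuperalgType K) :=
  {M of isLieSuperMod K g M & SuperSpace K M}.

Section Generalities.
Variable K : numFieldType.

Definition graded_subspace (V : superSpaceType K) (S : set V) : Prop :=
  subspace S /\
  forall x, S x -> exists x0 x1,
    [/\ S x0 /\ part false x0, S x1 /\ part true x1 & x = x0 + x1].

Variable g : lieSuperalgType K.

Definition subalgebra (S : set g) : Prop :=
  subspace S /\ forall x y, S x -> S y -> S (lie x y).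

(* Two-sided, since a graded left ideal is also a right ideal. *)
Definition ideal (I : set g) : Prop :=
  graded_subspace I /\ forall x y, I y -> I (lie x y).

Definition submodule (M : lieSuperModType g) (S : set M) : Prop :=
  graded_subspace S /\ forall (x : g) v, S v -> S (act x v).

Definition simple_module (M : lieSuperModType g) : Prop :=
  (exists v : M, v <> 0) /\
  forall S : set M, submodule S -> S = [set 0] \/ S = setT.

Section Contragredient.
Variables (n : nat) (e f h : 'I_n -> g).

Definition cartan : set g :=
  [set x | exists d : 'I_n -> K, x = \sum_(i < n) d i *: h i].

(* [g], with these generators, is the contragredient Lie superalgebra g(A)
   with parities p ([true] = odd), in the case where the h_i form a basis of
   the Cartan subalgebra: [contr_gen] and the relations present g as a graded
   quotient of the superalgebra defined by the relations, [contr_free] says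
   that the kernel meets the span of the h_i trivially, and [contr_max] that
   it is maximal with this property. *)
Record contragredient (A : 'M[K]_n) (p : 'I_n -> bool) : Prop := {
  contr_e : forall i, part (p i) (e i);
  contr_f : forall i, part (p i) (f i);
  contr_h : forall i, part false (h i);
  contr_hh : forall i j, lie (h i) (h j) = 0;
  contr_ef : forall i j, lie (e i) (f j) = if i == j then h i else 0;
  contr_he : forall i j, lie (h i) (e j) = A i j *: e j;
  contr_hf : forall i j, lie (h i) (f j) = - (A i j *: f j);
  contr_gen : forall S : set g, subalgebra S ->
    (forall i, [/\ S (e i), S (f i) & S (h i)]) -> S = setT;
  contr_free : forall d : 'I_n -> K,
    \sum_(i < n) d i *: h i = 0 -> forall i, d i = 0;
  contr_max : forall I : set g, ideal I -> I `&` cartan = [set 0] ->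
    I = [set 0]
}.

(* A weight, i.e. an element of the dual of the Cartan subalgebra, is given by
   the row vector of its values on the basis h_0, ..., h_(n-1). *)
Definition root_space (gam : 'rV[K]_n) : set g :=
  [set x | forall i, lie (h i) x = gam 0 i *: x].

Definition even_roots : set 'rV[K]_n :=
  [set gam | gam <> 0 /\
             exists x, [/\ root_space gam x, part false x & x <> 0]].

Definition weight_space (M : lieSuperModType g) (mu : 'rV[K]_n) : set M :=
  [set v | forall i, act (h i) v = mu 0 i *: v].

Definition highest_weight_module (pos : set 'rV[K]_n) (lam : 'rV[K]_n)
    (M : lieSuperModType g) : Prop :=
  exists v : M,
    [/\ v <> 0 /\ (exists a, part a v),
        weight_space lam v,
        forall gam x, pos gam -> root_space gam x -> act x v = 0
      & forall S : set M, submodule S -> S v -> S = setT].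

(* The simple highest weight module L(lam), determined up to isomorphism
   and parity shift. *)
Definition simple_highest_weight (pos : set 'rV[K]_n) (lam : 'rV[K]_n)
    (M : lieSuperModType g) : Prop :=
  simple_module M /\ highest_weight_module pos lam M.

Definition inj_roots (M : lieSuperModType g) : set 'rV[K]_n :=
  [set gam | even_roots gam /\
     exists x : g, [/\ root_space gam x, x <> 0 & injective (act x : M -> M)]].

End Contragredient.
End Generalities.

(* The indices 1, 2, 3 of the mathematical notation. *)
Definition i1 : 'I_3 := @Ordinal 3 0 isT.
Definition i2 : 'I_3 := @Ordinal 3 1 isT.
Definition i3 : 'I_3 := @Ordinal 3 2 isT.

Section D21.
Variables (K : numFieldType) (alpha : K).

Definition D21_cartan_matrix : 'M[K]_3 :=
  \matrix_(i < 3, j < 3)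
    nth 0 (nth [::] [:: [:: 0; 1; alpha];
                        [:: 1; 0; - alpha - 1];
                        [:: alpha; - alpha - 1; 0]] i) j.

(* All three simple roots are odd. *)
Definition is_D21 (g : lieSuperalgType K) (e f h : 'I_3 -> g) : Prop :=
  contragredient e f h D21_cartan_matrix (fun=> true).

(* beta_j(h_i) = a_ij *)
Definition beta (j : 'I_3) : 'rV[K]_3 := \row_i D21_cartan_matrix i j.

Definition D21_pos_even : set 'rV[K]_3 :=
  [set gam | [\/ gam = beta i1 + beta i2, gam = beta i1 + beta i3
               | gam = beta i2 + beta i3]].

Definition D21_pos_odd : set 'rV[K]_3 :=
  [set gam | [\/ gam = beta i1, gam = beta i2, gam = beta i3
               | gam = beta i1 + beta i2 + beta i3]].

Definition D21_pos : set 'rV[K]_3 := D21_pos_even `|` D21_pos_odd.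

Definition D21_neg_even : set 'rV[K]_3 :=
  [set gam | D21_pos_even (- gam)].

End D21.

(* Main.v *)
(* An even negative root vector F = [f_i, f_j] acts on L either injectively or
   locally nilpotently, and the latter holds iff F^n v = 0 for some n, v being
   the highest weight vector.  If lambda_i <> 0, then f_i v <> 0 is the highest
   weight vector for the base reflected in beta_i, in which beta_i + beta_j is
   simple; the sl_2-string w_n = F^n f_i v starts at weight c - 1, where
   c = (lambda_i + lambda_j) / a_ij.  So no w_n vanishes unless c is a positive
   integer, in which case e_i w_c, and then w_c, is killed by all e_l and
   is 0 by simplicity of L.  If lambda_i = lambda_j = 0, then f_i v = f_j v = 0
   and F v = 0.

   The roots of g are found from the Serre relations: a vector of positive weight
   killed by all f_l is 0 by maximality of the defining ideal, which gives
   [e_i, e_i] = 0 and a_ik [e_i, [e_j, e_k]] = a_jk [e_j, [e_i, e_k]], so that the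
   brackets of at most three e's or f's and the h's span g. *)

Require Import Defs.
From HB Require Import structures.
From mathcomp Require Import all_boot all_order all_algebra.
From mathcomp Require Import boolp classical_sets reals complex.
From mathcomp Require Import ring.

Import GRing.Theory Num.Theory.

Local Open Scope ring_scope.
Local Open Scope complex_scope.

Set Implicit Arguments.
Unset Strict Implicit.
Unset Printing Implicit Defensive.

(** * Linear spans and products of eigenvalue factors *)

Section Linear.
Variables (K : numFieldType) (V : lmodType K).
Implicit Types (S B C : set V).

Lemma subspace0 S : subspace S -> S 0.
Proof. by case. Qed.

Lemma subspaceD S x y : subspace S -> S x -> S y -> S (x + y).
Proof. by case=> _ S_lin Sx Sy; rewrite -[x]scale1r; apply: S_lin. Qed.

Lemma subspaceZ S a x : subspace S -> S x -> S (a *: x).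
Proof. by case=> S0 S_lin Sx; rewrite -[_ *: _]addr0; apply: S_lin. Qed.

Lemma subspaceN S x : subspace S -> S x -> S (- x).
Proof. by move=> S_sub Sx; rewrite -scaleN1r; apply: subspaceZ. Qed.

Lemma subspaceB S x y : subspace S -> S x -> S y -> S (x - y).
Proof. by move=> S_sub Sx Sy; apply: subspaceD => //; apply: subspaceN. Qed.

(** An intersection of subspaces, so that applying a membership proof to a subspace is induction
    over the span. *)
Definition linspan B : set V :=
  fun x => forall S, subspace S -> (forall y, B y -> S y) -> S x.

Lemma linspan_subspace B : subspace (linspan B).
Proof.
split=> [S [S0 _] _ //|a x y Bx By S S_sub BS].
by apply: S_sub.2; [apply: Bx | apply: By].
Qed.

Lemma sub_linspan B x : B x -> linspan B x.
Proof. by move=> Bx S _; apply. Qed.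

Lemma linspan_image (W : lmodType K) B (S : set W) (T : V -> W) :
  subspace S -> (forall a x y, T (a *: x + y) = a *: T x + T y) ->
  (forall x, B x -> S (T x)) -> forall x, linspan B x -> S (T x).
Proof.
move=> [S0 S_lin] T_lin BS x /(_ (fun y => S (T y))); apply=> //; split.
  suff -> : T 0 = 0 by [].
  by have /eqP := T_lin 1 0 0; rewrite !scale1r addr0 -subr_eq subrr => /eqP.
by move=> a y z Sy Sz; rewrite T_lin; apply: S_lin.
Qed.

(* The kernel of (T - m)(T - (m - 1))...(T - (m - (n - 1))). *)
Fixpoint kerprod (T : V -> V) (m : K) (n : nat) : set V :=
  if n is k.+1 then fun x => kerprod T m k (T x - (m - k%:R) *: x)
  else fun x => x = 0.

Section Kerprod.
Variables (T : V -> V) (m : K).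
Hypothesis T_lin : forall a x y, T (a *: x + y) = a *: T x + T y.

Lemma kerprod_subspace n : subspace (kerprod T m n).
Proof.
have T0 : T 0 = 0.
  by have /eqP := T_lin 1 0 0; rewrite !scale1r addr0 -subr_eq subrr => /eqP.
elim: n => [|n [IH0 IHl]] /=; split=> //.
- by move=> a x y -> ->; rewrite scaler0 addr0.
- by rewrite T0 scaler0 subr0.
- move=> a x y Kx Ky; have := IHl a _ _ Kx Ky.
  congr (kerprod _ _ _ _); rewrite T_lin !scalerDr scalerN !scalerA.
  by rewrite [a * _]mulrC opprD addrACA.
Qed.

(** [T] commutes with all the factors, so it preserves each kernel, and so does [T] minus a
    scalar. *)
Lemma kerprodS n x : kerprod T m n x -> kerprod T m n.+1 x.
Proof.
suff TK k y : kerprod T m k y -> kerprod T m k (T y).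
  move=> Kx /=; apply: subspaceB; first exact: kerprod_subspace.
    exact: TK.
  by apply: subspaceZ => //; apply: kerprod_subspace.
have T0 : T 0 = 0.
  by have /eqP := T_lin 1 0 0; rewrite !scale1r addr0 -subr_eq subrr => /eqP.
elim: k y => [|k IHk] y /=; first by move=> ->.
move=> /IHk; congr (kerprod _ _ _ _).
by rewrite addrC -scaleNr T_lin scaleNr addrC.
Qed.

Lemma leq_kerprod n k x : (n <= k)%N -> kerprod T m n x -> kerprod T m k x.
Proof.
move=> /subnK <-; elim: (k - n)%N => // p IHp /IHp.
by rewrite addSn; apply: kerprodS.
Qed.

(** Every vector of the span is killed by a product of factors [T - (m - k)]. On [v] these factors
    are the scalars [p + 1 + k], nonzero in characteristic 0. No decomposition into eigenspaces is
    required. *)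
Lemma linspan_eigen B p v :
  (forall x, B x -> exists k : nat, T x = (m - k%:R) *: x) ->
  T v = (m + p.+1%:R) *: v -> linspan B v -> v = 0.
Proof.
move=> B_eig Tv.
have K_sub : subspace (fun x => exists n, kerprod T m n x).
  split; first by exists 0%N.
  move=> a x y [k Kx] [l Ky]; exists (k + l)%N.
  apply: (kerprod_subspace _).2.
    by apply: leq_kerprod Kx; apply: leq_addr.
  by apply: leq_kerprod Ky; apply: leq_addl.
case/(_ _ K_sub) => [x /B_eig[k Tx]|n].
  exists k.+1; rewrite /= Tx subrr; exact: (subspace0 (kerprod_subspace _)).
elim: n => [|n IHn] //=; rewrite Tv -scalerBl => Kv; apply: IHn.
have c_neq0 : m + p.+1%:R - (m - n%:R) != 0.
  have -> : m + p.+1%:R - (m - n%:R) = (p.+1 + n)%:R by rewrite natrD; ring.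
  by rewrite pnatr_eq0.
have := subspaceZ ((m + p.+1%:R - (m - n%:R))^-1) (kerprod_subspace n) Kv.
by rewrite scalerA mulVf // scale1r.
Qed.

End Kerprod.
End Linear.

(** * Identities for the superbracket *)

Section Bracket.
Variables (K : numFieldType) (g : lieSuperalgType K).
Implicit Types x y z : g.

Lemma lieDl x y z : lie (x + y) z = lie x z + lie y z.
Proof. by have := lie_linearl 1 x y z; rewrite !scale1r. Qed.
Lemma lie0l z : lie 0 z = 0.
Proof. by have /eqP := lieDl 0 0 z; rewrite addr0 -subr_eq subrr => /eqP. Qed.
Lemma lieZl a x z : lie (a *: x) z = a *: lie x z.
Proof. by have := lie_linearl a x 0 z; rewrite lie0l !addr0. Qed.

Lemma lieDr z x y : lie z (x + y) = lie z x + lie z y.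
Proof. by have := lie_linearr 1 x y z; rewrite !scale1r. Qed.
Lemma lie0r z : lie z 0 = 0.
Proof. by have /eqP := lieDr z 0 0; rewrite addr0 -subr_eq subrr => /eqP. Qed.
Lemma lieZr a z x : lie z (a *: x) = a *: lie z x.
Proof. by have := lie_linearr a x 0 z; rewrite lie0r !addr0. Qed.
Lemma lieNr z x : lie z (- x) = - lie z x.
Proof. by rewrite -scaleN1r lieZr scaleN1r. Qed.
Lemma lieBr z x y : lie z (x - y) = lie z x - lie z y.
Proof. by rewrite lieDr lieNr. Qed.

Lemma lie_oddC x y : part true x -> part true y -> lie x y = lie y x.
Proof. by move=> px py; rewrite (lie_skew _ _ _ _ px py) expr1 scaleN1r opprK. Qed.

Lemma lie_evenC b x y : part false x -> part b y -> lie x y = - lie y x.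
Proof. by move=> px py; rewrite (lie_skew _ _ _ _ px py) expr0 scale1r. Qed.

Lemma lie_odd_lie x y z : part true x -> part true y ->
  lie x (lie y z) = lie (lie x y) z - lie y (lie x z).
Proof. by move=> px py; rewrite (lie_jacobi _ _ _ _ z px py) expr1 scaleN1r. Qed.

Lemma lie_even_lie b x y z : part false x -> part b y ->
  lie x (lie y z) = lie (lie x y) z + lie y (lie x z).
Proof. by move=> px py; rewrite (lie_jacobi _ _ _ _ z px py) expr0 scale1r. Qed.

Lemma lie_weight b (p q : K) t x y : part false t -> part b x ->
  lie t x = p *: x -> lie t y = q *: y ->
  lie t (lie x y) = (p + q) *: lie x y.
Proof.
by move=> pt px tx ty; rewrite (lie_even_lie _ pt px) tx ty lieZl lieZr scalerDl.
Qed.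

(** The Jacobi identity gives [2 [x, [x, z]] = [[x, x], z]]. *)
Lemma lie_sqr0 x z : part true x -> lie x x = 0 -> lie x (lie x z) = 0.
Proof.
move=> px xx0; have /eqP := lie_odd_lie z px px.
rewrite xx0 lie0l sub0r -addr_eq0 -mulr2n -scaler_nat scaler_eq0 pnatr_eq0.
by move=> /eqP.
Qed.

End Bracket.

(** * The action on a module *)

Section Action.
Variables (K : numFieldType) (g : lieSuperalgType K) (M : lieSuperModType g).
Implicit Types (x y : g) (v w : M).

Lemma actDl x y v : act (x + y) v = act x v + act y v.
Proof. by have := act_linearl 1 x y v; rewrite !scale1r. Qed.
Lemma act0l v : act (0 : g) v = 0.
Proof. by have /eqP := actDl 0 0 v; rewrite addr0 -subr_eq subrr => /eqP. Qed.
Lemma actZl a x v : act (a *: x) v = a *: act x v.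
Proof. by have := act_linearl a x 0 v; rewrite act0l !addr0. Qed.
Lemma actNl x v : act (- x) v = - act x v.
Proof. by rewrite -scaleN1r actZl scaleN1r. Qed.

Lemma actDr x v w : act x (v + w) = act x v + act x w.
Proof. by have := act_linearr 1 x v w; rewrite !scale1r. Qed.
Lemma act0r x : act x (0 : M) = 0.
Proof. by have /eqP := actDr x 0 0; rewrite addr0 -subr_eq subrr => /eqP. Qed.
Lemma actZr a x v : act x (a *: v) = a *: act x v.
Proof. by have := act_linearr a x v 0; rewrite act0r !addr0. Qed.
Lemma actNr x v : act x (- v) = - act x v.
Proof. by rewrite -scaleN1r actZr scaleN1r. Qed.

Lemma act_lie_odd x y v : part true x -> part true y ->
  act (lie x y) v = act x (act y v) + act y (act x v).
Proof. by move=> px py; rewrite (act_lie _ _ _ _ v px py) expr1 scaleN1r opprK. Qed.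

Lemma act_lie_even b x y v : part false x -> part b y ->
  act (lie x y) v = act x (act y v) - act y (act x v).
Proof. by move=> px py; rewrite (act_lie _ _ _ _ v px py) expr0 scale1r. Qed.

Lemma act_weight b (p q : K) t x v : part false t -> part b x ->
  lie t x = p *: x -> act t v = q *: v ->
  act t (act x v) = (p + q) *: act x v.
Proof.
move=> pt px tx tv; have := act_lie_even v pt px.
rewrite tx tv actZl actZr => /eqP; rewrite eq_sym subr_eq => /eqP ->.
by rewrite -scalerDl.
Qed.

End Action.

Lemma act_suml (K : numFieldType) (g : lieSuperalgType K)
    (M : lieSuperModType g) n (d : 'I_n -> K) (h : 'I_n -> g) (v : M) :
  act (\sum_i d i *: h i) v = \sum_i d i *: act (h i) v.
Proof.
rewrite (big_morph (fun x => act x v) (fun x y => actDl x y v) (act0l v)).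
by apply: eq_bigr => i _; rewrite actZl.
Qed.

(** * The adjoint module and graded spans *)

(** A copy of [g] that carries the adjoint action, so that results on modules apply to [g]
    itself. *)
Definition adjoint (K : numFieldType) (g : lieSuperalgType K) : Type := g.

Section Adjoint.
Variables (K : numFieldType) (g : lieSuperalgType K).

HB.instance Definition _ := SuperSpace.on (adjoint g).

Let ad (x : g) (y : adjoint g) : adjoint g := lie x (y : g).

Let ad_linearl a x y v : ad (a *: x + y) v = a *: ad x v + ad y v.
Proof. exact: lie_linearl. Qed.

Let ad_linearr a x u v : ad x (a *: u + v) = a *: ad x u + ad x v.
Proof. exact: lie_linearr. Qed.

Let ad_part a b x (v : adjoint g) :
  part a x -> part b v -> part (a (+) b) (ad x v).
Proof. exact: lie_part. Qed.

Let ad_lie a b x y v : part a x -> part b y ->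
  ad (lie x y) v = ad x (ad y v) - (-1) ^+ (a && b) *: ad y (ad x v).
Proof.
by move=> px py; rewrite /ad (lie_jacobi _ _ _ _ (v : g) px py) addrK.
Qed.

HB.instance Definition _ :=
  isLieSuperMod.Build K g (adjoint g) ad_linearl ad_linearr ad_part ad_lie.

End Adjoint.

Section Parts.
Variables (K : numFieldType) (V : superSpaceType K).

Lemma linspan_graded (B : set V) :
  (forall x, B x -> exists b, part b x) -> graded_subspace (linspan B).
Proof.
move=> B_hom; split; first exact: linspan_subspace.
have sp := linspan_subspace B; have ps b := part_subspace (s := V) b.
pose P x := exists x0 x1, [/\ linspan B x0 /\ part false x0,
  linspan B x1 /\ part true x1 & x = x0 + x1].
move=> x /(_ P); apply; last first.
  move=> y By; have [[] py] := B_hom y By; [exists 0, y | exists y, 0].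
    split; last by rewrite add0r.
      split; [exact: subspace0 | exact: (subspace0 (ps false))].
    by split=> //; apply: sub_linspan.
  split; last by rewrite addr0.
    by split=> //; apply: sub_linspan.
  split; [exact: subspace0 | exact: (subspace0 (ps true))].
split.
  exists 0, 0; rewrite addr0; split=> //; split=> //.
  - exact: subspace0.
  - exact: (subspace0 (ps false)).
  - exact: subspace0.
  - exact: (subspace0 (ps true)).
move=> a _ _ [y0 [y1 [[Sy0 py0] [Sy1 py1] ->]]] [z0 [z1 [[Sz0 pz0] [Sz1 pz1] ->]]].
exists (a *: y0 + z0), (a *: y1 + z1); split.
- by split; [apply: sp.2 | apply: (ps false).2].
- by split; [apply: sp.2 | apply: (ps true).2].
- by rewrite scalerDr addrACA.
Qed.

End Parts.

(** * Submodules generated by singular vectors *)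

Section Generation.
Variables (K : numFieldType) (g : lieSuperalgType K).
Variables (n : nat) (e f h : 'I_n -> g) (A : 'M[K]_n).
Hypothesis gC : contragredient e f h A (fun=> true).

(** For odd generators [[f_i, e_i] = [e_i, f_i]], so exchanging e and f keeps the [h i] and negates
    the Cartan matrix. Every statement on the e's thus yields one on the f's. *)
Lemma contragredient_swap : contragredient f e h (- A) (fun=> true).
Proof.
case: (gC) => Ce Cf Ch Chh Cef Che Chf Cgen Cfree Cmax.
split=> // [i j|i j|i j|S S_sub Sfeh].
- by rewrite (lie_oddC (Cf i) (Ce j)) Cef eq_sym; case: eqP => // ->.
- by rewrite Chf mxE scaleNr.
- by rewrite Che mxE scaleNr opprK.
- by apply: Cgen => // i; have [] := Sfeh i.
Qed.

(** The elements preserving [S] are closed under brackets and contain the generators, since [h_i =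
    [e_i, f_i]]. *)
Lemma stable_submodule (M : lieSuperModType g) (S : set M) : subspace S ->
  (forall i v, S v -> S (act (e i) v)) -> (forall i v, S v -> S (act (f i) v)) ->
  forall x v, S v -> S (act x v).
Proof.
move=> S_sub Se Sf; pose pres x := forall v, S v -> S (act x v).
have pres_sub : subspace pres.
  split=> [v _|a x y Px Py v Sv]; first by rewrite act0l; apply: subspace0.
  by rewrite act_linearl; apply: S_sub.2; [apply: Px | apply: Py].
have pres_lie a b x y : part a x -> part b y -> pres x -> pres y -> pres (lie x y).
  move=> px py Px Py v Sv; rewrite (act_lie _ _ _ _ v px py).
  by apply: subspaceB => //; [|apply: subspaceZ => //];
    [apply/Px/Py | apply/Py/Px].
have ps b := part_subspace (s := g) b.
(* [act_lie] concerns homogeneous elements only, so both homogeneous parts are required to preserve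
   [S]. *)
pose P x := exists x0 x1,
  [/\ part false x0 /\ pres x0, part true x1 /\ pres x1 & x = x0 + x1].
have P_sub : subspace P.
  split.
    exists 0, 0; rewrite addr0; split=> //; split.
    - exact: (subspace0 (ps false)).
    - exact: (subspace0 pres_sub).
    - exact: (subspace0 (ps true)).
    - exact: (subspace0 pres_sub).
  move=> a _ _ [y0 [y1 [[py0 Sy0] [py1 Sy1] ->]]] [z0 [z1 [[pz0 Sz0] [pz1 Sz1] ->]]].
  exists (a *: y0 + z0), (a *: y1 + z1); split.
  - by split; [apply: (ps false).2 | apply: pres_sub.2].
  - by split; [apply: (ps true).2 | apply: pres_sub.2].
  - by rewrite scalerDr addrACA.
have odd_P x : part true x -> pres x -> P x.
  move=> px Sx; exists 0, x; rewrite add0r; split=> //; split.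
    exact: (subspace0 (ps false)).
  exact: (subspace0 pres_sub).
suff PT : P = setT.
  move=> x v Sv; have : P x by rewrite PT.
  by case=> x0 [x1 [[_ Sx0] [_ Sx1] ->]]; rewrite actDl; apply: subspaceD;
    [|apply: Sx0|apply: Sx1].
apply: (contr_gen gC); last first.
  move=> i; split.
  - by apply: odd_P; [apply: (contr_e gC) | apply: Se].
  - by apply: odd_P; [apply: (contr_f gC) | apply: Sf].
  - exists (h i), 0; rewrite addr0; split=> //; split; first exact: (contr_h gC).
    + have := contr_ef gC i i; rewrite eqxx => <-.
      by apply: (pres_lie true true); [apply: (contr_e gC) | apply: (contr_f gC)
        | apply: Se | apply: Sf].
    + exact: (subspace0 (ps true)).
    + exact: (subspace0 pres_sub).
split=> // _ _ [y0 [y1 [[py0 Sy0] [py1 Sy1] ->]]] [z0 [z1 [[pz0 Sz0] [pz1 Sz1] ->]]].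
exists (lie y0 z0 + lie y1 z1), (lie y0 z1 + lie y1 z0); split.
- split.
    by apply: (subspaceD (ps false)); [exact: (lie_part _ _ _ _ py0 pz0)
      | exact: (lie_part _ _ _ _ py1 pz1)].
  by apply: (subspaceD pres_sub); [apply: (pres_lie false false)
    | apply: (pres_lie true true)].
- split.
    by apply: (subspaceD (ps true)); [exact: (lie_part _ _ _ _ py0 pz1)
      | exact: (lie_part _ _ _ _ py1 pz0)].
  by apply: (subspaceD pres_sub); [apply: (pres_lie false true)
    | apply: (pres_lie true false)].
- by rewrite lieDl !lieDr [lie y1 z0 + _]addrC addrACA.
Qed.

Section Singular.
Variables (M : lieSuperModType g) (u : M) (b : bool) (mu : 'I_n -> K).
Hypotheses (u_part : part b u) (eu0 : forall i, act (e i) u = 0)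
  (hu : forall i, act (h i) u = mu i *: u).

Let fword (s : seq 'I_n) : M := foldr (fun i => act (f i)) u s.

Let fword_part s : exists c, part c (fword s).
Proof.
elim: s => [|i s [c IHs]] /=; first by exists b.
by exists (true (+) c); apply: act_part IHs; apply: (contr_f gC).
Qed.

Let fword_weight s i : act (h i) (fword s) = (mu i - \sum_(j <- s) A i j) *: fword s.
Proof.
elim: s => [|j s IHs] /=; first by rewrite big_nil subr0.
rewrite (act_weight (contr_h gC i) (contr_f gC j) (p := - A i j) _ IHs).
  by rewrite big_cons; congr (_ *: _); ring.
by rewrite (contr_hf gC) scaleNr.
Qed.

(** [S] is spanned by the words in the f's applied to [u]; it is stable under the e's by moving
    [e i] to the right through a word. The element [\sum_i d i *: h i] measures height: each letter
    lowers its eigenvalue by 1, so no eigenvalue in [S] exceeds that of [u]. *)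
Lemma singular_submodule (d : 'I_n -> K) :
  (forall j, \sum_i d i * A i j = 1) ->
  exists S : set M, [/\ submodule S, S u & forall v (p : nat),
    act (\sum_i d i *: h i) v = (\sum_i d i * mu i + p.+1%:R) *: v ->
    S v -> v = 0].
Proof.
move=> dA; pose B := range fword; exists (linspan B).
have sub := linspan_subspace B.
have Bf i v' : linspan B v' -> linspan B (act (f i) v').
  apply: (linspan_image sub (fun a => act_linearr a (f i))) => _ [s _ <-].
  by apply: sub_linspan; exists (i :: s).
split; last first.
- move=> v p dv.
  apply: (linspan_eigen (fun a => act_linearr a (\sum_i d i *: h i)) _ dv).
  move=> _ [s _ <-].
  exists (size s); rewrite act_suml.
  under eq_bigr do rewrite fword_weight scalerA.
  rewrite -scaler_suml; congr (_ *: _).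
  under eq_bigr do rewrite mulrBr mulr_sumr.
  rewrite sumrB exchange_big /=; congr (_ - _).
  under eq_bigr do rewrite dA.
  by rewrite big_const_seq count_predT iter_addr addr0.
- by apply: sub_linspan; exists [::].
split; first by apply: linspan_graded => _ [s _ <-]; apply: fword_part.
apply: stable_submodule => // i.
apply: (linspan_image sub (fun a => act_linearr a (e i))) => _ [s _ <-].
elim: s => [|j s IHs] /=; first by rewrite eu0; apply: (subspace0 sub).
have := act_lie_odd (fword s) (contr_e gC i) (contr_f gC j).
rewrite (contr_ef gC) => /esym/eqP; rewrite eq_sym -subr_eq => /eqP <-.
apply: (subspaceB sub); last exact: Bf.
case: eqP => _; last by rewrite act0l; apply: (subspace0 sub).
rewrite fword_weight; apply: (subspaceZ _ sub).
by apply: sub_linspan; exists s.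
Qed.

End Singular.

(** If [u] were nonzero, the submodule it generates would be [L] and contain [v], whose height
    exceeds that of [u] by [size s]. *)
Lemma singular_simple (d : 'I_n -> K) (L : lieSuperModType g) (v u : L)
    (b : bool) (lam : 'I_n -> K) (s : seq 'I_n) :
  (forall j, \sum_i d i * A i j = 1) -> simple_module L -> v <> 0 ->
  (forall i, act (h i) v = lam i *: v) -> part b u ->
  (forall i, act (e i) u = 0) ->
  (forall i, act (h i) u = (lam i - \sum_(j <- s) A i j) *: u) ->
  (0 < size s)%N -> u = 0.
Proof.
move=> dA [_ L_simple] v0 hv u_part eu hu s_gt0.
have [S [S_sub Su Sv]] := singular_submodule u_part eu hu dA.
have [S0|ST] := L_simple S S_sub; first by move: Su; rewrite S0.
case: v0; apply: (Sv _ (size s).-1); last by rewrite ST.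
  rewrite act_suml; under eq_bigr do rewrite hv scalerA.
  rewrite -scaler_suml; congr (_ *: _).
  rewrite prednK //; under [X in _ = X + _]eq_bigr do rewrite mulrBr mulr_sumr.
  rewrite sumrB exchange_big /=.
  under [X in _ = _ - X + _]eq_bigr do rewrite dA.
  by rewrite big_const_seq count_predT iter_addr addr0 subrK.
Qed.

End Generation.

(* The ideal generated by z lies in the positive weight spaces, so it misses
   the Cartan subalgebra; hence it is 0 by maximality. *)
Lemma singular_adjoint (K : numFieldType) (g : lieSuperalgType K) n
    (e f h : 'I_n -> g) (A : 'M[K]_n) (d : 'I_n -> K) (z : g) b (s : seq 'I_n) :
  contragredient e f h A (fun=> true) ->
  (forall j, \sum_i d i * A i j = 1) -> part b z ->
  (forall i, lie (f i) z = 0) ->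
  (forall i, lie (h i) z = (\sum_(j <- s) A i j) *: z) ->
  (0 < size s)%N -> z = 0.
Proof.
move=> gC dA zb fz hz s_gt0.
pose mu i := \sum_(j <- s) A i j.
have gC' := contragredient_swap gC.
have dA' j : \sum_i (- d i) * (- A) i j = 1.
  by rewrite -[RHS](dA j); apply: eq_bigr => i _; rewrite mxE mulrNN.
(* With e and f exchanged, the height of [z] is [- size s], and the Cartan subalgebra, of height 0,
   lies strictly above it. *)
have dmu : \sum_i (- d i) * mu i + (size s).-1.+1%:R = 0.
  rewrite prednK // /mu; under eq_bigr do rewrite mulNr mulr_sumr.
  rewrite sumrN exchange_big /=; under eq_bigr do rewrite dA.
  by rewrite big_const_seq count_predT iter_addr addr0 addNr.
have dh (x : adjoint g) : cartan h x -> act (\sum_i - d i *: h i) x = 0.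
  move=> [c cx]; rewrite act_suml big1 // => i _.
  suff -> : act (h i) x = 0 by rewrite scaler0.
  change (lie (h i) (x : g) = 0).
  rewrite cx (big_morph (lie (h i)) (lieDr _) (lie0r _)) big1 // => k _.
  by rewrite lieZr (contr_hh gC) scaler0.
have [I [I_sub Iz Iv]] := singular_submodule gC' (M := adjoint g) zb fz hz dA'.
have I0 : I = [set 0]%classic.
  apply: (contr_max gC) => //; apply/seteqP; split=> [x [Ix hx]|_ ->].
    by apply: (Iv _ (size s).-1) => //; rewrite dmu scale0r; apply: dh.
  split; first exact: (subspace0 I_sub.1.1).
  by exists (fun=> 0); rewrite big1 // => i _; rewrite scale0r.
by move: Iz; rewrite I0.
Qed.

(** * Triples of indices and Cartan matrices of type D(2,1,alpha) *)

(* These conditions are stable under A |-> -A and permutations of the indices,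
   unlike the shape of D21_cartan_matrix. *)
Record D21_type (K : numFieldType) (A : 'M[K]_3) : Prop := {
  D21_sym : forall i j, A i j = A j i;
  D21_diag : forall i, A i i = 0;
  D21_neq0 : forall i j, i != j -> A i j != 0;
  D21_sum : forall i j k, i != j -> i != k -> j != k ->
    A i j + A i k + A j k = 0
}.

Lemma ord3P (i : 'I_3) : [\/ i = i1, i = i2 | i = i3].
Proof.
by case: i => [[|[|[|]]] // i_lt]; [constructor 1 | constructor 2 | constructor 3];
  apply: val_inj.
Qed.

Lemma ord3_third (i j : 'I_3) : i != j -> exists k, i != k /\ j != k.
Proof.
by case: (ord3P i) => ->; case: (ord3P j) => -> // _;
  solve [by exists i1 | by exists i2 | by exists i3].
Qed.

Lemma ord3_cover (i j k : 'I_3) : i != j -> i != k -> j != k ->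
  forall l, [\/ l = i, l = j | l = k].
Proof.
move=> ij ik jk l; have: [|| l == i, l == j | l == k].
  move: ij ik jk; case: (ord3P i) => ->; case: (ord3P j) => -> //;
  by case: (ord3P k) => -> //; case: (ord3P l) => ->.
by case/or3P=> /eqP->; [constructor 1 | constructor 2 | constructor 3].
Qed.

Lemma sum_ord3 (V : nmodType) (F : 'I_3 -> V) i j k :
  i != j -> i != k -> j != k -> \sum_l F l = F i + F j + F k.
Proof.
move=> ij ik jk; rewrite (bigD1 i) //= (bigD1 j) /=; last by rewrite eq_sym.
rewrite (bigD1 k) /=; last by rewrite ![k == _]eq_sym ik jk.
rewrite big1 ?addr0 ?addrA // => l /andP[/andP[]].
by case: (ord3_cover ij ik jk l) => ->; rewrite eqxx.
Qed.

Lemma D21_typeN (K : numFieldType) (A : 'M[K]_3) : D21_type A -> D21_type (- A).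
Proof.
case=> A_sym A_diag A_neq0 A_sum; split=> [i j|i|i j|i j k] *; rewrite !mxE.
- by rewrite A_sym.
- by rewrite A_diag oppr0.
- by rewrite oppr_eq0; apply: A_neq0.
- by rewrite -!opprD A_sum ?oppr0.
Qed.

Lemma D21_cartan_type (K : numFieldType) (alpha : K) :
  alpha <> 0 -> alpha <> -1 -> D21_type (D21_cartan_matrix alpha).
Proof.
move=> /eqP a0 /eqP a1.
have a1' : - alpha - 1 != 0 by rewrite -opprD oppr_eq0 addr_eq0.
split=> [i j|i|i j|i j k].
- by case: (ord3P i) => ->; case: (ord3P j) => ->; rewrite !mxE.
- by case: (ord3P i) => ->; rewrite !mxE.
- by case: (ord3P i) => ->; case: (ord3P j) => -> // _; rewrite mxE ?oner_eq0.
- case: (ord3P i) => ->; case: (ord3P j) => -> //; case: (ord3P k) => -> //;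
  by rewrite !mxE /= => _ _ _; ring.
Qed.

(** * Serre relations *)

Section D21.
Variables (K : numFieldType) (g : lieSuperalgType K) (e f h : 'I_3 -> g).
Variable A : 'M[K]_3.
Hypotheses (gC : contragredient e f h A (fun=> true)) (AD : D21_type A).

(* sum_i d_i h_i = H_1 + H_2 + H_3 acts by 1 on each e_j; the diagonal
   entries of A do not contribute, since 0^-1 = 0. *)
Lemma D21_height j : \sum_i (\sum_l (A i l)^-1) * A i j = 1.
Proof.
have [k jk] : exists k, j != k.
  by case: (ord3P j) => ->; [exists i2 | exists i1 | exists i1].
have [l [jl kl]] := ord3_third jk.
rewrite (sum_ord3 _ jk jl kl) (D21_diag AD) mulr0 add0r.
rewrite !(sum_ord3 _ jk jl kl) !(D21_diag AD) invr0 addr0.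
rewrite (D21_sym AD k j) (D21_sym AD l j) (D21_sym AD l k).
have := D21_sum AD jk jl kl; have := D21_neq0 AD jk; have := D21_neq0 AD jl.
have := D21_neq0 AD kl; rewrite addr0.
move: (A j k) (A j l) (A k l) => a b c c0 b0 a0 abc.
have aE : a = - b - c by apply: (addIr (b + c)); rewrite addrA abc; ring.
by move: a0; rewrite {}aE => a0; field; rewrite a0 b0 c0.
Qed.

Let pe i : part true (e i). Proof. exact: (contr_e gC). Qed.
Let pf i : part true (f i). Proof. exact: (contr_f gC). Qed.
Let ph i : part false (h i). Proof. exact: (contr_h gC). Qed.
Let pee i j : part false (lie (e i) (e j)).
Proof. exact: (lie_part _ _ _ _ (pe i) (pe j)). Qed.
Let peee i j k : part true (lie (e i) (lie (e j) (e k))).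
Proof. exact: (lie_part _ _ _ _ (pe i) (pee j k)). Qed.

Lemma lie_eC i j : lie (e i) (e j) = lie (e j) (e i).
Proof. exact: lie_oddC. Qed.

Lemma lie_h_ee l i j :
  lie (h l) (lie (e i) (e j)) = (A l i + A l j) *: lie (e i) (e j).
Proof. by apply: lie_weight; rewrite ?(contr_he gC). Qed.

Lemma lie_h_eee l i j k : lie (h l) (lie (e i) (lie (e j) (e k))) =
  (A l i + (A l j + A l k)) *: lie (e i) (lie (e j) (e k)).
Proof. by apply: lie_weight (lie_h_ee _ _ _); rewrite ?(contr_he gC). Qed.

Lemma lie_fe l i : lie (f l) (e i) = if l == i then h i else 0.
Proof. by rewrite lie_oddC // (contr_ef gC) eq_sym. Qed.

(** The indicator coefficients treat all coincidences of indices at once. *)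
Lemma lie_f_ee l i j : lie (f l) (lie (e i) (e j)) =
  ((l == i)%:R * A i j) *: e j + ((l == j)%:R * A j i) *: e i.
Proof.
rewrite lie_odd_lie // !lie_fe; congr (_ + _).
  by case: eqP; rewrite ?lie0l ?mul0r ?scale0r // mul1r (contr_he gC).
case: eqP; rewrite ?lie0r ?mul0r ?scale0r ?oppr0 // => _.
by rewrite -(lie_evenC (ph _) (pe _)) mul1r (contr_he gC).
Qed.

Lemma lie_f_eee l i j k : lie (f l) (lie (e i) (lie (e j) (e k))) =
  ((l == i)%:R * (A i j + A i k)) *: lie (e j) (e k)
  - (((l == j)%:R * A j k) *: lie (e i) (e k)
     + ((l == k)%:R * A k j) *: lie (e i) (e j)).
Proof.
rewrite lie_odd_lie // lie_fe lie_f_ee lieDr !lieZr; congr (_ - _).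
by case: eqP; rewrite ?lie0l ?mul0r ?scale0r // mul1r lie_h_ee.
Qed.

(** Since [A i i = 0], all [f l] kill this vector, and [singular_adjoint] applies. *)
Lemma lie_ee0 i : lie (e i) (e i) = 0.
Proof.
apply: (singular_adjoint gC D21_height (pee i i) (s := [:: i; i])) => // l.
  by rewrite lie_f_ee (D21_diag AD) mulr0 scale0r addr0.
by rewrite lie_h_ee !big_cons big_nil addr0.
Qed.

(** The difference of the two sides is killed by all [f l]: for [l = i] and [l = j] the coefficient
    is a multiple of [A i j + A i k + A j k = 0], and for [l = k] the two terms cancel by symmetry
    of [A]. *)
Lemma lie_eee_exchange i j k : i != j -> i != k -> j != k ->
  A i k *: lie (e i) (lie (e j) (e k)) = A j k *: lie (e j) (lie (e i) (e k)).
Proof.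
move=> ij ik jk; apply/eqP; rewrite -subr_eq0; apply/eqP.
apply: (singular_adjoint gC D21_height (b := true) (s := [:: i; j; k])) => //.
- have p_sub := part_subspace (s := g) true.
  by apply: (subspaceB p_sub); apply: (subspaceZ _ p_sub).
- move=> l; rewrite lieBr !lieZr !lie_f_eee.
  have sum0 := D21_sum AD ij ik jk.
  have [-> | -> | ->] := ord3_cover ij ik jk l.
  + rewrite eqxx (negbTE ij) (negbTE ik) !mul0r !scale0r addr0 !mul1r subr0.
    rewrite addr0 sub0r scalerN opprK !scalerA -scalerDl.
    rewrite [_ + _](_ : _ = A i k * (A i j + A i k + A j k)); last by ring.
    by rewrite sum0 mulr0 scale0r.
  + rewrite eqxx [j == i]eq_sym (negbTE ij) (negbTE jk) !mul0r !scale0r !mul1r.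
    rewrite !addr0 subr0 sub0r scalerN -opprD !scalerA -scalerDl.
    rewrite (D21_sym AD j i).
    rewrite [_ + _](_ : _ = A j k * (A i j + A i k + A j k)); last by ring.
    by rewrite sum0 mulr0 scale0r oppr0.
  + rewrite eqxx ![k == _]eq_sym (negbTE ik) (negbTE jk) !mul0r !scale0r !mul1r.
    rewrite !add0r !scalerN !scalerA (lie_eC j i) -opprB opprK.
    rewrite (D21_sym AD k i) (D21_sym AD k j) mulrC.
    by rewrite addNr oppr0.
- move=> l; rewrite lieBr !lieZr !lie_h_eee !big_cons big_nil addr0.
  by rewrite scalerBr !scalerA; congr (_ *: _ - _ *: _); ring.
Qed.

Lemma lie_eee0 i j k : ~~ [&& i != j, i != k & j != k] ->
  lie (e i) (lie (e j) (e k)) = 0.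
Proof.
rewrite !negb_and !negbK => /or3P[] /eqP->.
- by apply: lie_sqr0 => //; apply: lie_ee0.
- by rewrite (lie_eC j); apply: lie_sqr0 => //; apply: lie_ee0.
- by rewrite lie_ee0 lie0r.
Qed.

(** The exchange relation makes a nonzero triple bracket proportional to one that begins with [e l],
    and bracketing twice with [e l] gives 0. *)
Lemma lie_eeee0 l i j k : lie (e l) (lie (e i) (lie (e j) (e k))) = 0.
Proof.
have [/and3P[ij ik jk]|/lie_eee0->] := boolP [&& i != j, i != k & j != k]; last first.
  by rewrite lie0r.
have main i' j' k' : i' != j' -> i' != k' -> j' != k' ->
    lie (e j') (lie (e i') (lie (e j') (e k'))) = 0.
  move=> ij' ik' jk'; have /eqP := congr1 (lie (e j')) (lie_eee_exchange ij' ik' jk').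
  rewrite !lieZr (lie_sqr0 _ (pe j') (lie_ee0 j')) scaler0 scaler_eq0.
  by rewrite (negbTE (D21_neq0 AD ik')) => /eqP.
have [-> | -> | ->] := ord3_cover ij ik jk l.
  by apply: lie_sqr0 => //; apply: lie_ee0.
  exact: main.
by rewrite (lie_eC j k); apply: main => //; rewrite eq_sym.
Qed.

End D21.

(** * Splitting off eigenvectors of an operator with eigenvalues 0, a, -a, 2a, -2a *)

Section Spectral.
Variables (K : numFieldType) (V : lmodType K) (T : V -> V) (a : K).
Hypotheses (TD : forall x y, T (x + y) = T x + T y)
  (TZ : forall c x, T (c *: x) = c *: T x) (a0 : a != 0).
Variables d o y z : V.
Hypotheses (Td : T d = 0) (To : T (T o) = a ^+ 2 *: o)
  (Ty : T y = (2 * a) *: y) (Tz : T z = - (2 * a) *: z).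

(** Only [T^2] is prescribed on [o], which may mix the eigenvalues [a] and [-a]. Comparing [T^2] on
    [d + o + y] gives [3 a^2 o = - 4 a^2 d]; applying [T] then yields [T o = 0], whence [o], [d] and
    finally [y] vanish. *)
Lemma eigen_extract : T (d + o + y + z) = - (2 * a) *: (d + o + y + z) ->
  d + o + y + z = z.
Proof.
rewrite TD Tz [in RHS]scalerDr => /addIr Tw.
suff [-> -> ->] : [/\ d = 0, o = 0 & y = 0] by rewrite !add0r.
have T0 : T 0 = 0 by have := TZ 0 0; rewrite !scale0r.
have T2 : a ^+ 2 *: o + (2 * a) ^+ 2 *: y = (2 * a) ^+ 2 *: (d + o + y).
  have <- : T (T (d + o + y)) = a ^+ 2 *: o + (2 * a) ^+ 2 *: y.
    by rewrite !TD Td T0 add0r To Ty TZ Ty scalerA -expr2.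
  by rewrite Tw TZ Tw scalerA mulrNN -expr2.
have {T2} od : (3 * a ^+ 2) *: o = - (2 * a) ^+ 2 *: d.
  move: T2; rewrite 2!scalerDr => /addIr/eqP; rewrite -subr_eq -scalerBl => /eqP.
  by rewrite scaleNr => <-; rewrite -scaleNr; congr (_ *: _); ring.
have a2 : a ^+ 2 != 0 by rewrite expf_neq0.
have To0 : T o = 0.
  have /eqP := congr1 T od; rewrite !TZ Td scaler0 scaler_eq0 mulf_eq0.
  by rewrite (negbTE a2) pnatr_eq0 => /eqP.
have o0 : o = 0.
  by move/eqP: To; rewrite To0 T0 eq_sym scaler_eq0 (negbTE a2) => /eqP.
have d0 : d = 0.
  move/esym/eqP: od; rewrite o0 scaler0 scaler_eq0 oppr_eq0 expf_eq0 mulf_eq0.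
  by rewrite (negbTE a0) pnatr_eq0 => /eqP.
split=> //; apply/eqP; move/eqP: Tw; rewrite d0 o0 !add0r Ty -subr_eq0 -scalerBl.
by rewrite scaler_eq0 opprK -mulr2n mulrn_eq0 mulf_eq0 (negbTE a0) pnatr_eq0.
Qed.

(** Computing [T x] and [T^2 x] gives [t (t + 2 a) x = 8 a^2 y]. Either [t = - 2 a] and [y = 0], or
    [x] is a multiple of [y], which forces [t = 2 a]. *)
Lemma eigen_even (t : K) : d + y + z != 0 -> t != 0 ->
  T (d + y + z) = t *: (d + y + z) ->
  t = 2 * a /\ d + y + z = y \/ t = - (2 * a) /\ d + y + z = z.
Proof.
set x := d + y + z => x0 t0 Tx.
have Tx1 : t *: x = (2 * a) *: y - (2 * a) *: z.
  by rewrite -Tx /x !TD Td add0r Ty Tz scaleNr.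
have Tx2 : t ^+ 2 *: x = (2 * a) ^+ 2 *: y + (2 * a) ^+ 2 *: z.
  rewrite expr2 -scalerA -Tx -TZ Tx1 TD -scaleNr !TZ Ty Tz !scalerA.
  by rewrite mulrNN -expr2.
have a2 : 2 * a != 0 by rewrite mulf_neq0 ?pnatr_eq0.
have c0 : 2 * (2 * a) ^+ 2 != 0 by rewrite mulf_neq0 ?expf_neq0 ?pnatr_eq0.
have yE : (t * (t + 2 * a)) *: x = (2 * (2 * a) ^+ 2) *: y.
  have Tx3 : (t * (2 * a)) *: x = (2 * a) ^+ 2 *: y - (2 * a) ^+ 2 *: z.
    by rewrite mulrC -scalerA Tx1 scalerBr !scalerA -expr2.
  rewrite mulrDr -expr2 scalerDl Tx2 Tx3 addrACA subrr addr0 -scalerDl.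
  by congr (_ *: _); ring.
have [/eqP|tn] := eqVneq (t + 2 * a) 0.
  rewrite addr_eq0 => /eqP tE; right; split=> //.
  move: yE; rewrite tE addNr mulr0 scale0r => /esym/eqP.
  rewrite scaler_eq0 (negbTE c0) => /eqP y_0; apply: (scalerI t0).
  by rewrite Tx1 y_0 scaler0 sub0r tE scaleNr.
have k0 : t * (t + 2 * a) != 0 by rewrite mulf_neq0.
have tE : t = 2 * a.
  have /eqP : t * (t + 2 * a) * t *: x = 2 * a * (t * (t + 2 * a)) *: x.
    rewrite -scalerA -Tx -TZ yE TZ Ty -[RHS]scalerA yE !scalerA.
    by congr (_ *: _); ring.
  rewrite -subr_eq0 -scalerBl scaler_eq0 (negbTE x0) orbF mulrC -mulrBl mulf_eq0.
  by rewrite (negbTE k0) orbF subr_eq0 => /eqP.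
left; split=> //; apply: (scalerI c0); rewrite -yE tE.
by congr (_ *: _); ring.
Qed.

End Spectral.

(** * A spanning set of g *)

Inductive D21_frame (K : numFieldType) (g : lieSuperalgType K)
    (e f h : 'I_3 -> g) : g -> Prop :=
| frame_e i : D21_frame e f h (e i)
| frame_f i : D21_frame e f h (f i)
| frame_h i : D21_frame e f h (h i)
| frame_ee i j : D21_frame e f h (lie (e i) (e j))
| frame_ff i j : D21_frame e f h (lie (f i) (f j))
| frame_eee i j k : D21_frame e f h (lie (e i) (lie (e j) (e k)))
| frame_fff i j k : D21_frame e f h (lie (f i) (lie (f j) (f k))).

Section Frame.
Variables (K : numFieldType) (g : lieSuperalgType K) (e f h : 'I_3 -> g).
Variable A : 'M[K]_3.
Hypotheses (gC : contragredient e f h A (fun=> true)) (AD : D21_type A).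

(** Bracketing with [e l] lengthens words in the e's, up to length three by [lie_eeee0], and
    shortens words in the f's. The frame keeps vanishing and proportional brackets, which spares a
    case analysis on indices. *)
Lemma frame_stable_e l x :
  linspan (D21_frame e f h) x -> linspan (D21_frame e f h) (lie (e l) x).
Proof.
have gC' := contragredient_swap gC.
have sp := linspan_subspace (D21_frame e f h).
have s0 := subspace0 sp; have sD x y := subspaceD (x := x) (y := y) sp.
have sZ a y := subspaceZ (x := y) a sp; have sN y := subspaceN (x := y) sp.
apply: (linspan_image sp (fun a x y => lie_linearr a x y (e l))).
move=> _ [i|i|i|i j|i j|i j k|i j k].
- by apply: sub_linspan; constructor.
- rewrite (contr_ef gC); case: eqP => // _; apply: sub_linspan; constructor.
- rewrite -[lie _ _]opprK -(lie_evenC (contr_h gC i) (contr_e gC l)) (contr_he gC).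
  by apply: (sN); apply: (sZ); apply: sub_linspan; constructor.
- by apply: sub_linspan; constructor.
- by rewrite (lie_f_ee gC'); apply: (sD); apply: (sZ); apply: sub_linspan; constructor.
- by rewrite (lie_eeee0 gC AD).
- rewrite (lie_f_eee gC'); apply: (sD); last (apply: (sN); apply: (sD));
    by apply: (sZ); apply: sub_linspan; constructor.
Qed.

End Frame.

(** * Even roots and their root spaces *)

Section Roots.
Variables (K : numFieldType) (g : lieSuperalgType K) (e f h : 'I_3 -> g).
Variable A : 'M[K]_3.
Hypotheses (gC : contragredient e f h A (fun=> true)) (AD : D21_type A).

(** Stability under the e's, and by exchange under the f's, gives stability under all of [g]; the
    span is then a subalgebra containing the generators. *)
Lemma frame_full x : linspan (D21_frame e f h) x.
Proof.
have sp := linspan_subspace (D21_frame e f h).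
have st : forall y z, linspan (D21_frame e f h) z ->
    linspan (D21_frame e f h) (lie y z).
  apply: (stable_submodule gC (M := adjoint g) sp) => i z.
    exact: (frame_stable_e gC AD).
  have swap u : linspan (D21_frame e f h) u <-> linspan (D21_frame f e h) u.
    by split; apply: (linspan_image (T := id)) => //; try exact: linspan_subspace;
      move=> _ [] *; apply: sub_linspan; constructor.
  move=> /swap/(frame_stable_e (contragredient_swap gC) (D21_typeN AD) i).
  by move=> /swap.
suff -> : linspan (D21_frame e f h) = setT by [].
apply: (contr_gen gC).
  by split=> // y z _; apply: st.
by move=> i; split; apply: sub_linspan; constructor.
Qed.

Variables i j : 'I_3.
Hypothesis ij : i != j.

(** The eigenvalue of [h i + h j] on [e l]: it is [A i j] for [l = i] and [l = j], and [- A i j] for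
    the third index. *)
Let t l := A i l + A j l.

Let ti : t i = A i j.
Proof. by rewrite /t (D21_diag AD) add0r (D21_sym AD). Qed.

Let tj : t j = A i j.
Proof. by rewrite /t (D21_diag AD) addr0. Qed.

Let tk k : i != k -> j != k -> t k = - A i j.
Proof.
move=> ik jk; have /eqP := D21_sum AD ij ik jk.
by rewrite -addrA addr_eq0 => /eqP->; rewrite opprK.
Qed.

Let t_sqr l : t l ^+ 2 = A i j ^+ 2.
Proof.
have [k [ik jk]] := ord3_third ij.
by case: (ord3_cover ij ik jk l) => ->; rewrite ?ti ?tj ?(tk ik jk) ?sqrrN.
Qed.

Let t_sum l m n : l != m -> l != n -> m != n -> t l + (t m + t n) = A i j.
Proof.
move=> lm ln mn; rewrite addrA -(sum_ord3 t lm ln mn).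
have [k [ik jk]] := ord3_third ij.
by rewrite (sum_ord3 t ij ik jk) ti tj tk // addrK.
Qed.

Let hij_weight (x : g) p q : lie (h i) x = p *: x -> lie (h j) x = q *: x ->
  lie (h i + h j) x = (p + q) *: x.
Proof. by move=> hi hj; rewrite lieDl hi hj scalerDl. Qed.

(* Decomposition of g under the Cartan element H = h_i + h_j of the
   sl_2-triple of the root beta_i + beta_j: d has weight 0, o is odd of
   weights +-1 and the last two terms have weights +-2, in units of a_ij. *)
Lemma D21_decomposition x : exists d o p q,
  [/\ part false d, lie (h i + h j) d = 0, part true o,
      lie (h i + h j) (lie (h i + h j) o) = A i j ^+ 2 *: o &
      x = d + o + p *: lie (e i) (e j) + q *: lie (f i) (f j)].
Proof.
set H := h i + h j.
have gC' := contragredient_swap gC; have AD' := D21_typeN AD.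
have ps b := part_subspace (s := g) b.
have p0 b := subspace0 (ps b).
pose P y := exists d o p q,
  [/\ part false d, lie H d = 0, part true o,
      lie H (lie H o) = A i j ^+ 2 *: o &
      y = d + o + p *: lie (e i) (e j) + q *: lie (f i) (f j)].
apply: (frame_full x (S := P)) => [|u Fu].
  split.
    exists 0, 0, 0, 0; split=> //; rewrite ?lie0r ?scaler0 //.
    by rewrite !scale0r !addr0.
  move=> a _ _ [d [o [p [q [pd Hd po Ho ->]]]]] [d' [o' [p' [q' [pd' Hd' po' Ho' ->]]]]].
  exists (a *: d + d'), (a *: o + o'), (a * p + p'), (a * q + q'); split.
  - exact: (ps false).2.
  - by rewrite lie_linearr Hd Hd' scaler0 addr0.
  - exact: (ps true).2.
  - by rewrite !lie_linearr Ho Ho' scalerDr !scalerA mulrC.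
  - rewrite !scalerDr !scalerDl !scalerA addrACA; congr (_ + _).
    by rewrite addrACA; congr (_ + _); rewrite addrACA.
have oddP y (c : K) : part true y -> lie H y = c *: y -> c ^+ 2 = A i j ^+ 2 -> P y.
  move=> py Hy c2; exists 0, y, 0, 0; split=> //; rewrite ?lie0r //.
    by rewrite Hy lieZr Hy scalerA -expr2 c2.
  by rewrite !scale0r !addr0 add0r.
have evenP y : part false y -> lie H y = 0 -> P y.
  move=> py Hy; exists y, 0, 0, 0; split=> //; rewrite ?lie0r ?scaler0 //.
  by rewrite !scale0r !addr0.
have zeroP : P 0 by apply: evenP; rewrite ?lie0r.
have pe l := contr_e gC l; have pf l := contr_f gC l.
have pee l m := lie_part _ _ _ _ (pe l) (pe m).
have pff l m := lie_part _ _ _ _ (pf l) (pf m).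
have peee l m n := lie_part _ _ _ _ (pe l) (pee m n).
have pfff l m n := lie_part _ _ _ _ (pf l) (pff m n).
have eP : P (lie (e i) (e j)).
  exists 0, 0, 1, 0; split=> //; rewrite ?lie0r ?scaler0 //.
  by rewrite scale0r !addr0 add0r scale1r.
have fP : P (lie (f i) (f j)).
  exists 0, 0, 0, 1; split=> //; rewrite ?lie0r ?scaler0 //.
  by rewrite scale0r !addr0 add0r scale1r.
have [k [ik jk]] := ord3_third ij; have cov := ord3_cover ij ik jk.
(* A nonzero odd frame vector has eigenvalue [A i j] or [- A i j]; a nonzero even one has eigenvalue
   0 unless it is the bracket of the two e's or of the two f's with indices i, j. *)
case: Fu => [l|l|l|l m|l m|l m n|l m n].
- apply: (oddP _ (t l)) => //; apply: hij_weight; exact: (contr_he gC).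
- apply: (oddP _ (- t l)); rewrite ?sqrrN // opprD; apply: hij_weight;
  by rewrite (contr_hf gC) scaleNr.
- by apply: evenP; [apply: (contr_h gC) | rewrite lieDl !(contr_hh gC) addr0].
- have Hee l' m' : t l' + t m' = 0 -> P (lie (e l') (e m')).
    move=> t0; apply: evenP => //.
    by rewrite (hij_weight (lie_h_ee gC i l' m') (lie_h_ee gC j l' m')) addrACA
      -/(t l') -/(t m') t0 scale0r.
  case: (cov l) => ->; case: (cov m) => ->;
    try solve [ by rewrite (lie_ee0 gC AD) | exact: eP
              | by rewrite (lie_eC gC); exact: eP
              | by apply: Hee; rewrite ?ti ?tj ?(tk ik jk) ?subrr ?addNr ].
- have Hff l' m' : t l' + t m' = 0 -> P (lie (f l') (f m')).
    move=> t0; apply: evenP => //.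
    rewrite (hij_weight (lie_h_ee gC' i l' m') (lie_h_ee gC' j l' m')) addrACA !mxE.
    by rewrite -!opprD -/(t l') -/(t m') t0 oppr0 scale0r.
  case: (cov l) => ->; case: (cov m) => ->;
    try solve [ by rewrite (lie_ee0 gC' AD') | exact: fP
              | by rewrite (lie_eC gC'); exact: fP
              | by apply: Hff; rewrite ?ti ?tj ?(tk ik jk) ?subrr ?addNr ].
- have [/and3P[lm ln mn]|/(lie_eee0 gC AD)->//] := boolP [&& l != m, l != n & m != n].
  apply: (oddP _ (t l + (t m + t n))); rewrite ?t_sum //.
  rewrite -[A i j](t_sum lm ln mn) /t.
  rewrite (hij_weight (lie_h_eee gC i l m n) (lie_h_eee gC j l m n)).
  by congr (_ *: _); ring.
- have [/and3P[lm ln mn]|/(lie_eee0 gC' AD')->//] := boolP [&& l != m, l != n & m != n].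
  apply: (oddP _ (- (t l + (t m + t n)))); rewrite ?sqrrN ?t_sum //.
  rewrite -[A i j](t_sum lm ln mn) /t.
  rewrite (hij_weight (lie_h_eee gC' i l m n) (lie_h_eee gC' j l m n)) !mxE.
  by congr (_ *: _); ring.
Qed.

Let Hee p : lie (h i + h j) (p *: lie (e i) (e j)) =
  (2 * A i j) *: (p *: lie (e i) (e j)).
Proof.
rewrite lieZr (hij_weight (lie_h_ee gC i i j) (lie_h_ee gC j i j)).
rewrite !(D21_diag AD) (D21_sym AD j i) !scalerA; congr (_ *: _); ring.
Qed.

Let Hff p : lie (h i + h j) (p *: lie (f i) (f j)) =
  - (2 * A i j) *: (p *: lie (f i) (f j)).
Proof.
have gC' := contragredient_swap gC.
rewrite lieZr (hij_weight (lie_h_ee gC' i i j) (lie_h_ee gC' j i j)) !mxE.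
rewrite !(D21_diag AD) (D21_sym AD j i) !scalerA; congr (_ *: _); ring.
Qed.

(** On this root space [h i + h j] has eigenvalue [- 2 A i j], carried only by the last term of the
    decomposition. *)
Lemma neg_root_space (gam : 'rV[K]_3) x :
  (forall l, gam 0 l = - (A l i + A l j)) -> root_space h gam x ->
  exists q, x = q *: lie (f i) (f j).
Proof.
move=> gamE gx; have [d [o [p [q [_ Hd _ Ho xE]]]]] := D21_decomposition x.
exists q; rewrite xE.
apply: (eigen_extract (T := lie (h i + h j)) (lieDr _) (fun c => lieZr c _)
  (D21_neq0 AD ij) Hd Ho (Hee p) (Hff q)).
rewrite -xE (hij_weight (gx i) (gx j)) !gamE !(D21_diag AD) (D21_sym AD j i).
by congr (_ *: _); ring.
Qed.

(** Parity removes the odd term, and the nonzero eigenvalue of [h i + h j] leaves a multiple of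
    [[e_i, e_j]] or of [[f_i, f_j]], whose weights are known. *)
Lemma even_root_pair (gam : 'rV[K]_3) x : gam 0 i + gam 0 j != 0 ->
  root_space h gam x -> part false x -> x != 0 ->
  (forall l, gam 0 l = A l i + A l j) \/ (forall l, gam 0 l = - (A l i + A l j)).
Proof.
move=> t0 gx px; have [d [o [p [q [pd Hd po _ xE]]]]] := D21_decomposition x.
have ps b := part_subspace (s := g) b.
have pee := lie_part _ _ _ _ (contr_e gC i) (contr_e gC j).
have pff := lie_part _ _ _ _ (contr_f gC i) (contr_f gC j).
have o0 : o = 0.
  apply: part_direct => //.
  have -> : o = x - (d + p *: lie (e i) (e j) + q *: lie (f i) (f j)).
    by rewrite xE [d + o]addrC -2!(addrA o) addrK.
  apply: (subspaceB (ps false)) => //.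
  apply: (subspaceD (ps false)); last exact: (subspaceZ _ (ps false)).
  by apply: (subspaceD (ps false)) => //; exact: (subspaceZ _ (ps false)).
rewrite {}o0 addr0 in xE => x0.
have x0' : d + p *: lie (e i) (e j) + q *: lie (f i) (f j) != 0 by rewrite -xE.
have Hx : lie (h i + h j) (d + p *: lie (e i) (e j) + q *: lie (f i) (f j)) =
    (gam 0 i + gam 0 j) *: (d + p *: lie (e i) (e j) + q *: lie (f i) (f j)).
  by rewrite -xE (hij_weight (gx i) (gx j)).
have wt c l : lie (h l) x = c *: x -> gam 0 l = c.
  rewrite gx => /eqP; rewrite -subr_eq0 -scalerBl scaler_eq0 (negbTE x0) orbF.
  by rewrite subr_eq0 => /eqP.
have gC' := contragredient_swap gC.
have := eigen_even (lieDr _) (fun c => lieZr c _) (D21_neq0 AD ij) Hd (Hee p)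
  (Hff q) x0' t0 Hx.
rewrite -xE => -[[_ xE']|[_ xE']]; [left|right] => l; apply: wt; rewrite xE' lieZr.
  by rewrite (lie_h_ee gC) !scalerA mulrC.
by rewrite (lie_h_ee gC') !mxE -opprD !scalerA mulrC.
Qed.

End Roots.

(** * Vectors on which an even element is nilpotent *)

Section Nilpotent.
Variables (K : numFieldType) (g : lieSuperalgType K) (M : lieSuperModType g).
Variable F : g.
Hypothesis F_even : part false F.

Definition nilpotent_on : set M := fun w => exists n, iter n (act F) w = 0.

Let iter0 n : iter n (act F) (0 : M) = 0.
Proof. by elim: n => //= n ->; rewrite act0r. Qed.

Let iter_lin n (a : K) (x y : M) : iter n (act F) (a *: x + y) =
  a *: iter n (act F) x + iter n (act F) y.
Proof. by elim: n => //= n ->; rewrite act_linearr. Qed.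

Let iter_part n b (x : M) : part b x -> part b (iter n (act F) x).
Proof. by move=> px; elim: n => //= n IHn; apply: (act_part false b). Qed.

(** [F] is even, so [F^n x0] and [F^n x1] have opposite parities; as their sum is 0, both vanish. *)
Lemma nilpotent_on_graded : graded_subspace nilpotent_on.
Proof.
split=> [|x [n Fx]].
  split; first by exists 0%N.
  move=> a x y [n Fx] [m Fy]; exists (n + m)%N.
  by rewrite iter_lin addnC iterD Fx iter0 scaler0 add0r addnC iterD Fy iter0.
have [x0 [x1 [px0 px1 xE]]] := part_total x.
have F01 : iter n (act F) x0 = - iter n (act F) x1.
  apply/eqP; rewrite -addr_eq0 -[iter n _ x0]scale1r -iter_lin scale1r -xE.
  exact/eqP.
have Fx1 : iter n (act F) x1 = 0.
  apply: part_direct; last exact: iter_part.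
  rewrite -[iter n _ x1]opprK -F01.
  by apply: (subspaceN (part_subspace (s := M) false)); apply: iter_part.
exists x0, x1; split=> //; split=> //; exists n => //.
by rewrite F01 Fx1 oppr0.
Qed.

(** [F x w = x F w + [F, x] w] and [[F, x]] commutes with [F], so one more power of [F] suffices. *)
Lemma nilpotent_on_act b x w : part b x -> lie F (lie F x) = 0 ->
  nilpotent_on w -> nilpotent_on (act x w).
Proof.
move=> px FFx [n Fw]; exists n.+1; elim: n => [|n IHn] in w Fw *.
  by rewrite /= in Fw; rewrite Fw act0r iter0.
set y := lie F x; have py : part b y := lie_part _ _ _ _ F_even px.
have Fy m u : iter m (act F) (act y u) = act y (iter m (act F) u).
  elim: m => //= m ->; apply/eqP; rewrite -subr_eq0.
  by rewrite -(act_lie_even _ F_even py) FFx act0l.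
rewrite iterSr.
have -> : act F (act x w) = 1 *: act x (act F w) + act y w.
  by rewrite scale1r (act_lie_even _ F_even px) addrC subrK.
by rewrite iter_lin IHn ?Fy ?Fw ?act0r ?scaler0 ?addr0 // -iterSr.
Qed.

End Nilpotent.

(** * Injectivity of the even negative root vectors on a simple module *)

Section HighestWeight.
Variables (K : numFieldType) (g : lieSuperalgType K) (e f h : 'I_3 -> g).
Variable A : 'M[K]_3.
Hypotheses (gC : contragredient e f h A (fun=> true)) (AD : D21_type A).
Variables (L : lieSuperModType g) (v : L) (b : bool) (lam : 'I_3 -> K).
Hypotheses (L_simple : simple_module L) (v0 : v <> 0) (pv : part b v).
Hypotheses (ev : forall l, act (e l) v = 0).
Hypotheses (hv : forall l, act (h l) v = lam l *: v).

Let gC' := contragredient_swap gC.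
Let AD' := D21_typeN AD.
Let pe l : part true (e l). Proof. exact: (contr_e gC). Qed.
Let pf l : part true (f l). Proof. exact: (contr_f gC). Qed.

Lemma singular0 (u : L) c (s : seq 'I_3) : part c u -> (forall l, act (e l) u = 0) ->
  (forall l, act (h l) u = (lam l - \sum_(m <- s) A l m) *: u) ->
  (0 < size s)%N -> u = 0.
Proof. exact: (singular_simple gC (D21_height AD) L_simple v0 hv). Qed.

Lemma act_ef l m (u : L) : act (e l) (act (f m) u) =
  (if l == m then act (h m) u else 0) - act (f m) (act (e l) u) :> L.
Proof.
have /eqP := act_lie_odd u (pe l) (pf m).
rewrite (contr_ef gC) -subr_eq => /eqP <-; congr (_ - _).
by case: eqP => [->|] //; rewrite act0l.
Qed.

(** [e_l f_l v = lam_l v = 0], so [f_l v] is singular of weight below that of [v]. *)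
Lemma f_vanishes l : lam l = 0 -> act (f l) v = 0.
Proof.
move=> lam0; apply: (singular0 (c := true (+) b) (s := [:: l])) => //.
- exact: act_part.
- by move=> m; rewrite act_ef ev act0r hv lam0 scale0r subr0; case: eqP.
- move=> m; rewrite big_seq1.
  rewrite (act_weight (contr_h gC m) (pf l) (p := - A m l) _ (hv m)).
    by rewrite addrC.
  by rewrite (contr_hf gC) scaleNr.
Qed.

Section Pair.
Variables i j : 'I_3.
Hypothesis ij : i != j.

Let F := lie (f i) (f j).
Let pF : part false F. Proof. exact: (lie_part _ _ _ _ (pf i) (pf j)). Qed.

Let lie_F_f l : l = i \/ l = j -> lie F (f l) = 0.
Proof.
move=> l_ij; rewrite (lie_evenC pF (pf l)) /F.
case: l_ij => ->; last rewrite (lie_eC gC');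
by rewrite lie_sqr0 ?oppr0 // (lie_ee0 gC' AD').
Qed.

Let lie_e_F l : lie (e l) F =
  - ((l == i)%:R * A i j *: f j + (l == j)%:R * A i j *: f i).
Proof.
rewrite /F (lie_f_ee gC') !mxE (D21_sym AD j i).
by rewrite !mulrN !scaleNr opprD.
Qed.

(** The square of ad F kills each generator: [[F, e_l]] is a combination of [f_i] and [f_j], which
    commute with [F], and [[F, [F, f_l]]] consists of brackets of more than three f's. *)
Lemma nilpotent_on_submodule : submodule (nilpotent_on (M := L) F).
Proof.
have Ngr := nilpotent_on_graded L pF; split=> //.
apply: (stable_submodule gC Ngr.1) => l w.
- apply: (nilpotent_on_act pF (pe l)).
  rewrite (lie_evenC pF (pe l)) lie_e_F opprK lieDr !lieZr.
  by rewrite lie_F_f ?lie_F_f ?scaler0 ?addr0; [|left|right].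
- apply: (nilpotent_on_act pF (pf l)); rewrite (lie_evenC pF (pf l)) lieNr.
  have := lie_odd_lie (lie (f l) F) (pf i) (pf j).
  rewrite /F !(lie_eeee0 gC' AD') !lie0r subr0 => <-; exact: oppr0.
Qed.

(** By simplicity the [F]-nilpotent vectors form either 0, and then [F] has no kernel, or all of
    [L], and then [v] is among them. *)
Lemma act_F_inj : injective (act F : L -> L) <->
  forall n, iter n (act F) v <> 0.
Proof.
split=> [F_inj n Fv|Fv x y Fxy].
  apply: v0; elim: n Fv => //= n IHn Fv; apply/IHn/F_inj.
  by rewrite Fv act0r.
have [N0|NT] := L_simple.2 _ nilpotent_on_submodule.
  have : nilpotent_on (M := L) F (x - y).
    by exists 1%N; rewrite /= actDr actNr Fxy subrr.
  by rewrite N0 => /eqP; rewrite subr_eq0 => /eqP.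
have [n Fvn] : nilpotent_on (M := L) F v by rewrite NT.
by case: (Fv n).
Qed.

Let w n : L := iter n (act F) (act (f i) v).

Let act_f_F (u : L) : act (f i) (act F u) = act F (act (f i) u).
Proof.
apply/eqP; rewrite eq_sym -subr_eq0 -(act_lie_even _ pF (pf i)) lie_F_f ?act0l //.
by left.
Qed.

Let f_w n : act (f i) (w n) = 0.
Proof.
elim: n => [|n IHn]; last by rewrite /w /= act_f_F IHn act0r.
have /esym/eqP := act_lie_odd v (pf i) (pf i).
rewrite (lie_ee0 gC' AD') act0l -mulr2n -scaler_nat scaler_eq0 pnatr_eq0.
by move=> /eqP.
Qed.

Let act_e_F l (u : L) : act (e l) (act F u) = act F (act (e l) u)
  - ((l == i)%:R * A i j *: act (f j) u + (l == j)%:R * A i j *: act (f i) u).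
Proof.
have := act_lie _ _ _ _ u (pe l) pF; rewrite lie_e_F expr0 scale1r actNl actDl.
by rewrite !actZl => ->; rewrite addrC subrK.
Qed.

(** [[e_j, F]] is a multiple of [f_i], which kills the whole string; hence the start at [f_i v]
    rather than at [v]. *)
Let e_w l n : l != i -> act (e l) (w n) = 0.
Proof.
move=> li; elim: n => [|n IHn].
  by rewrite /w /= act_ef (negbTE li) ev act0r subr0.
rewrite /w /= act_e_F -/(w n) IHn f_w (negbTE li) mul0r scale0r scaler0.
by rewrite act0r addr0 subr0.
Qed.

(** The simple roots subtracted from [lam] in the weight of [w n]. *)
Let ws n : seq 'I_3 := iter n (fun s => [:: i, j & s]) [:: i].

Let h_w l n : act (h l) (w n) = (lam l - \sum_(m <- ws n) A l m) *: w n.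
Proof.
elim: n => [|n IHn] /=.
  rewrite (act_weight (contr_h gC l) (pf i) (p := - A l i) _ (hv l)).
    by rewrite big_seq1 addrC.
  by rewrite (contr_hf gC) scaleNr.
rewrite (act_weight (contr_h gC l) pF _ IHn (p := - (A l i + A l j))).
  by rewrite !big_cons; congr (_ *: _); ring.
by rewrite /F (lie_h_ee gC') !mxE -opprD.
Qed.

Let w_part n : exists c, part c (w n).
Proof.
elim: n => [|n [c IHn]]; first by exists (true (+) b); apply: act_part.
by exists (false (+) c); apply: act_part.
Qed.

Let ws_sum n : \sum_(m <- ws n) A i m + \sum_(m <- ws n) A j m = A i j *+ n.*2.+1.
Proof.
elim: n => [|n IHn] /=.
  by rewrite !big_seq1 (D21_diag AD) add0r (D21_sym AD).
rewrite !big_cons !(D21_diag AD) (D21_sym AD j i) doubleS 2!mulrS -IHn; ring.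
Qed.

(** Moving [e_i], then [e_j], past [F] leaves [f_i e_i] and [e_j f_j]. On [w n] these act as [h_i]
    and [h_j], because [f_i] and [e_j] kill it. *)
Let ee_w_step n : act (e j) (act (e i) (w n.+1)) = act F (act (e j) (act (e i) (w n)))
  - (A i j * (lam i + lam j - A i j *+ n.*2.+1)) *: w n.
Proof.
have fe : act (f i) (act (e i) (w n)) = act (h i) (w n).
  have := act_ef i i (w n); rewrite eqxx f_w act0r => /esym/eqP.
  by rewrite subr_eq0 => /eqP.
rewrite [w n.+1]/= act_e_F -/(w n) eqxx (negbTE ij) mul0r scale0r addr0 mul1r.
rewrite actDr actNr actZr act_e_F eqxx [j == i]eq_sym (negbTE ij) mul0r scale0r.
rewrite add0r mul1r.
have ji : j != i by rewrite eq_sym.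
rewrite fe act_ef eqxx (e_w n ji) act0r subr0 !h_w -addrA -opprD; congr (_ - _).
rewrite -scalerDr -scalerDl scalerA -ws_sum; congr (_ * _ *: _).
by rewrite addrACA opprD.
Qed.

(* Since e_j kills w n, this is the action of the raising operator [e_i, e_j] of
   an sl_2-triple on a vector of its lowering string. *)
Let ee_w n : act (e j) (act (e i) (w n.+1)) =
  - (A i j * n.+1%:R * (lam i + lam j - A i j * n.+1%:R)) *: w n.
Proof.
elim: n => [|n IHn].
  rewrite ee_w_step [w 0]/= [act (e i) _]act_ef eqxx ev act0r subr0 hv actZr ev.
  by rewrite scaler0 act0r sub0r scaleNr !mulr1.
rewrite ee_w_step IHn actZr -[act F (w n)]/(w n.+1) -scaleNr -scalerDl.
have -> : A i j *+ n.+1.*2.+1 = A i j * ((n%:R + 1) * 2 + 1).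
  by rewrite -[LHS]mulr_natr -(natr1 n.+1.*2) -muln2 natrM -(natr1 n).
rewrite -[n.+2%:R]natr1 -[n.+1%:R]natr1; congr (_ *: _).
by move: (A i j) (lam i) (lam j) (n%:R) => a c d m; ring.
Qed.

Let ek_ei_w n k : k != i -> k != j -> act (e k) (act (e i) (w n)) = 0.
Proof.
move=> ki kj; elim: n => [|n IHn].
  by rewrite [act (e i) _]act_ef eqxx ev act0r subr0 hv actZr ev scaler0.
rewrite [w n.+1]/= act_e_F -/(w n) eqxx (negbTE ij) mul0r scale0r addr0 mul1r.
rewrite actDr actNr actZr act_e_F IHn act0r (negbTE ki) (negbTE kj) !mul0r !scale0r.
by rewrite addr0 subr0 act_ef (negbTE kj) e_w // act0r subr0 scaler0 subr0.
Qed.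

Lemma act_F_inj_lam_neq0 : lam i != 0 -> injective (act F : L -> L) <->
  forall n, lam i + lam j != A i j * n.+1%:R.
Proof.
move=> lam0; have a0 := D21_neq0 AD ij.
have w0 : w 0 <> 0.
  move=> fv0; have := act_ef i i v; rewrite [act (f i) v]fv0 eqxx ev !act0r subr0 hv.
  by move/esym/eqP; rewrite scaler_eq0 (negbTE lam0) => /eqP.
rewrite act_F_inj; split=> [Fv n|lamn n Fv].
  apply/eqP => lamE; have [c pw] := w_part n.+1.
  (* For [l = i] because [e_i] squares to 0, for [l = j] because the factor in [ee_w] vanishes, and
     for the third index by [ek_ei_w]. *)
  have eew l : act (e l) (act (e i) (w n.+1)) = 0.
    have [->|li] := eqVneq l i.
      have /esym/eqP := act_lie_odd (w n.+1) (pe i) (pe i).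
      rewrite (lie_ee0 gC AD) act0l -mulr2n -scaler_nat scaler_eq0 pnatr_eq0.
      by move=> /eqP.
    have [->|lj] := eqVneq l j; last exact: ek_ei_w.
    by rewrite ee_w lamE subrr mulr0 oppr0 scale0r.
  (* The raising operator [e_i] cancels the first letter of [ws n.+1], leaving the nonempty list
     [j :: ws n]. *)
  have eiw : act (e i) (w n.+1) = 0.
    apply: (singular0 (c := true (+) c) (s := j :: ws n)) => //.
      exact: act_part.
    move=> l; rewrite (act_weight (contr_h gC l) (pe i) (contr_he gC l i) (h_w l n.+1)).
    by rewrite /= !big_cons; congr (_ *: _); ring.
  have w_eq0 : w n.+1 = 0.
    apply: (singular0 pw _ (fun l => h_w l n.+1)) => // l.
    by have [->|li] := eqVneq l i; last exact: e_w.
  have F_inj := act_F_inj.2 Fv.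
  apply: w0; elim: n.+1 w_eq0 => // m IHm wm; apply/IHm/F_inj.
  by rewrite act0r.
(* [f_i] commutes with [F], so [w n = f_i F^n v]. *)
have {Fv} : w n = 0.
  have <- : act (f i) (iter n (act F) v) = w n.
    by elim: n {Fv} => //= n IHn; rewrite act_f_F IHn.
  by rewrite Fv act0r.
(* By [ee_w], [e_j e_i w_(n+1)] is a nonzero multiple of [w n], so vanishing descends to [w 0]. *)
elim: n => // n IHn wn0; apply: IHn; have /esym/eqP := ee_w n.
rewrite wn0 !act0r scaler_eq0 oppr_eq0 !mulf_eq0 (negbTE a0) pnatr_eq0 /=.
by rewrite subr_eq0 (negbTE (lamn n)) => /eqP.
Qed.

End Pair.

(** [[f_i, f_j]] is symmetric in i and j, so the string may start from whichever of the two
    coordinates of [lam] is nonzero; if both are 0, then [[f_i, f_j] v = 0]. *)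
Lemma act_ff_inj i j : i != j -> injective (act (lie (f i) (f j)) : L -> L) <->
  (forall n, (0 < n)%N -> (lam i + lam j) / A i j <> n%:R) /\
  ~~ ((lam i == 0) && (lam j == 0)).
Proof.
move=> ij; have a0 := D21_neq0 AD ij.
have cond : (forall n, lam i + lam j != A i j * n.+1%:R) <->
    (forall n, (0 < n)%N -> (lam i + lam j) / A i j <> n%:R).
  split=> [lamn [//|n] _ lamE|lamn n].
    by have /eqP := lamn n; apply; rewrite -lamE mulrC divfK.
  by apply/eqP => lamE; apply: (lamn n.+1) => //; rewrite lamE mulrAC divff // mul1r.
have [li0|li] := eqVneq (lam i) 0; last first.
  by rewrite (act_F_inj_lam_neq0 ij li) cond; split=> [|[]].
have [lj0|lj] := eqVneq (lam j) 0; last first.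
  rewrite (lie_eC gC') (act_F_inj_lam_neq0 _ lj) 1?eq_sym // addrC (D21_sym AD j i).
  by rewrite cond; split=> [|[]].
split=> [F_inj|[_ //]]; case: v0; apply: F_inj.
by rewrite act_lie_odd // !f_vanishes // !act0r addr0.
Qed.

End HighestWeight.

(** * From root vectors to the set of injective roots *)

Section InjRoots.
Variables (K : numFieldType) (alpha : K).

Lemma D21_pos_evenP (gam : 'rV[K]_3) :
  D21_pos_even alpha gam <->
  exists i j, i != j /\ gam = beta alpha i + beta alpha j.
Proof.
split=> [[]->|[i [j [ij ->]]]]; first by exists i1, i2.
- by exists i1, i3.
- by exists i2, i3.
move: ij; case: (ord3P i) => ->; case: (ord3P j) => -> // _.
- by constructor 1.
- by constructor 2.
- by rewrite addrC; constructor 1.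
- by constructor 3.
- by rewrite addrC; constructor 2.
- by rewrite addrC; constructor 3.
Qed.

Variables (g : lieSuperalgType K) (e f h : 'I_3 -> g).
Hypotheses (alpha_neq0 : alpha <> 0) (alpha_neqN1 : alpha <> -1).
Hypothesis gD : is_D21 alpha e f h.
Variables (lam : 'rV[K]_3) (L : lieSuperModType g).
Hypothesis L_lam : simple_highest_weight h (D21_pos alpha) lam L.

Let A := D21_cartan_matrix alpha.
Let AD : D21_type A := D21_cartan_type alpha_neq0 alpha_neqN1.

Let beta_pairE i j l : (beta alpha i + beta alpha j) 0 l = A l i + A l j.
Proof. by rewrite !mxE. Qed.

Lemma inj_roots_neg_even : inj_roots h L = D21_neg_even alpha <->
  forall i j, i != j -> injective (act (lie (f i) (f j)) : L -> L).
Proof.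
have [L_simple [v [[v0 _] _ pos_v _]]] := L_lam.
have root_ff i j : root_space h (- (beta alpha i + beta alpha j)) (lie (f i) (f j)).
  move=> l; rewrite mxE beta_pairE (lie_h_ee (contragredient_swap gD)).
  rewrite [(- D21_cartan_matrix alpha) l i]mxE.
  by rewrite [(- D21_cartan_matrix alpha) l j]mxE opprD.
split=> [injE i j ij|inj_ff].
  have : D21_neg_even alpha (- (beta alpha i + beta alpha j)).
    by apply/D21_pos_evenP; exists i, j; rewrite opprK.
  rewrite -injE => -[_ [x [xr _ x_inj]]].
  have gamE l : (- (beta alpha i + beta alpha j)) 0 l = - (A l i + A l j).
    by rewrite mxE beta_pairE.
  have [q xE] := neg_root_space gD AD ij gamE xr.
  by move=> u w Fuw; apply: x_inj; rewrite xE !actZl Fuw.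
apply/seteqP; split=> [gam [[gam0 [y [yr py y0]]] [x [xr _ x_inj]]]|gam].
  (* A weight whose three pair sums vanish is 0, since twice a coordinate is a combination of these
     sums. *)
  have [i [j [ij t0]]] : exists i j, i != j /\ gam 0 i + gam 0 j != 0.
    apply: contrapT => no; case: gam0; apply/rowP => l; rewrite mxE.
    have sum0 i j : i != j -> gam 0 i + gam 0 j = 0.
      by move=> ij; apply: contrapT => /eqP ?; apply: no; exists i, j.
    have [k lk] : exists k, l != k.
      by case: (ord3P l) => ->; [exists i2 | exists i1 | exists i1].
    have [m [lm km]] := ord3_third lk.
    have : gam 0 l *+ 2 = 0.
      rewrite -[RHS](subrr (gam 0 k + gam 0 m)) [in RHS]sum0 //.
      have -> : gam 0 l *+ 2 =
          gam 0 l + gam 0 k + (gam 0 l + gam 0 m) - (gam 0 k + gam 0 m) by ring.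
      by rewrite !sum0 // addr0.
    by move/eqP; rewrite mulrn_eq0 => /eqP.
  (* A positive root is excluded, as its root vectors kill [v]. *)
  have [gamE|gamE] := even_root_pair gD AD ij t0 yr py (introN eqP y0).
    case: v0; apply: x_inj; rewrite act0r; apply: pos_v xr.
    left; apply/D21_pos_evenP; exists i, j; split=> //.
    by apply/rowP => l; rewrite beta_pairE gamE.
  apply/D21_pos_evenP; exists i, j; split=> //.
  by apply/rowP => l; rewrite mxE beta_pairE gamE opprK.
move=> /D21_pos_evenP[i [j [ij gamE]]].
(* If the bracket were 0, its action would be zero and could not be injective, as [v] is nonzero. *)
have ff0 : lie (f i) (f j) <> 0.
  by move=> ff0; apply: v0; apply: (inj_ff i j ij); rewrite ff0 !act0l.
have gamE' : gam = - (beta alpha i + beta alpha j) by rewrite -gamE opprK.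
split; last first.
  by exists (lie (f i) (f j)); split=> //; [rewrite gamE' | apply: inj_ff].
split.
  move=> gam0; have /rowP/(_ i) := gamE.
  rewrite gam0 oppr0 beta_pairE (D21_diag AD) add0r mxE => /esym Aij0.
  by have := D21_neq0 AD ij; rewrite Aij0 eqxx.
exists (lie (f i) (f j)); split=> //; first by rewrite gamE'.
exact: (lie_part _ _ _ _ (contr_f gD i) (contr_f gD j)).
Qed.

Lemma act_ff_injP i j : i != j ->
  injective (act (lie (f i) (f j)) : L -> L) <->
  (forall n, (0 < n)%N -> (lam 0 i + lam 0 j) / A i j <> n%:R) /\
  ~~ ((lam 0 i == 0) && (lam 0 j == 0)).
Proof.
have [L_simple [v [[v0 [b pv]] hv pos_v _]]] := L_lam.
apply: (act_ff_inj gD AD L_simple v0 pv _ hv) => l.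
apply: pos_v (beta alpha l) _ _ _; last first.
  by move=> m; rewrite (contr_he gD) [beta _ _ _ _]mxE.
by right; case: (ord3P l) => ->; [constructor 1 | constructor 2 | constructor 3].
Qed.

End InjRoots.

Theorem theorem3p7 (R : realType) (alpha : R[i])
  (alpha_neq0 : alpha <> 0) (alpha_neqN1 : alpha <> -1)
  (g : lieSuperalgType R[i]) (e f h : 'I_3 -> g)
  (g_D21 : is_D21 alpha e f h)
  (lam : 'rV[R[i]]_3) (L : lieSuperModType g)
  (L_lam : simple_highest_weight h (D21_pos alpha) lam L) :
  let lam1 : R[i] := lam 0 i1 in
  let lam2 : R[i] := lam 0 i2 in
  let lam3 : R[i] := lam 0 i3 in
  let c1 : R[i] := (lam2 + lam3) / (- alpha - 1) in
  let c2 : R[i] := (lam1 + lam3) / alpha in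
  let c3 : R[i] := lam1 + lam2 in
  inj_roots h L = D21_neg_even alpha <->
  (forall n : nat, (1 <= n)%N ->
     [/\ c1 <> n%:R, c2 <> n%:R & c3 <> n%:R]) /\
  (#|[pred i : 'I_3 | lam 0%R i == 0%R]| <= 1)%N.
Proof.
move=> lam1 lam2 lam3 c1 c2 c3.
rewrite (inj_roots_neg_even alpha_neq0 alpha_neqN1 g_D21 L_lam).
have ffP := act_ff_injP alpha_neq0 alpha_neqN1 g_D21 L_lam.
pose c i j := (lam 0 i + lam 0 j) / D21_cartan_matrix alpha i j.
(* [c3] has no denominator because the corresponding matrix entry is 1. *)
have cE : [/\ c i2 i3 = c1, c i1 i3 = c2 & c i1 i2 = c3].
  by split; rewrite /c mxE //= divr1.
have cC i j : c i j = c j i.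
  by rewrite /c addrC (D21_sym (D21_cartan_type alpha_neq0 alpha_neqN1)).
case: cE => c1E c2E c3E; split=> [inj_ff|[c_notin card_le1] i j ij].
  split=> [n n_gt0|].
    rewrite -c1E -c2E -c3E; split.
    - exact: ((ffP i2 i3 isT).1 (inj_ff i2 i3 isT)).1.
    - exact: ((ffP i1 i3 isT).1 (inj_ff i1 i3 isT)).1.
    - exact: ((ffP i1 i2 isT).1 (inj_ff i1 i2 isT)).1.
  (* Two distinct vanishing coordinates would violate the condition for their pair. *)
  apply/card_le1_eqP => i j; rewrite !inE => /eqP li /eqP lj.
  apply/eqP/contraT => ij; have [_] := (ffP j i ij).1 (inj_ff j i ij).
  by rewrite li lj eqxx.
apply/(ffP i j ij); split=> [n n_gt0|].
  rewrite -/(c i j); have [] := c_notin n n_gt0; rewrite -c1E -c2E -c3E.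
  by move: ij; case: (ord3P i) => ->; case: (ord3P j) => -> // _ *; rewrite cC.
apply/negP => /andP[li lj]; move/card_le1_eqP: card_le1 => /(_ i j).
by rewrite !inE => /(_ li lj) ijE; rewrite ijE eqxx in ij.
Qed.
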